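(* Let $G$ be a compact connected Lie group, $H\subset G$ a closed connected subgroup with $\operatorname{rk}H=\operatorname{rk}G$, $T\subset H$ a common maximal torus, $\dim_{\mathbb{R}}G/H=2n$, and let $J$ be a $G$-invariant almost complex structure on $G/H$. Let $\theta$ be the canonical action $t(gH)=(tg)H$ of $T$ on $G/H$. Let $gH$ be a fixed point of $\theta$. Then the weights of the induced complex representation $d_g\theta$ of $T$ in $(T_{gH}(G/H),J)$ are obtained from the weights of the representation $d_e\theta$ of $T$ in $(T_{eH}(G/H),J)$ by the action of the Weyl group $W_G$, up to the action of the Weyl group $W_H$. That is, if $\Lambda_1,\dots,\Lambda_n$ are the weights at $eH$ and $gH=\mathrm{w}H$ with $\mathrm{w}\in N_G(T)$ representing a class in $W_G/W_H$, then the weights at $gH$ are $\mathrm{w}(\Lambda_1),\dots,\mathrm{w}(\Lambda_n)$.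
   Context: $W_G=N_G(T)/T$ and $W_H=N_H(T)/T$ are the Weyl groups; $W_G$ acts on weights (characters of $T$) in the usual way, $(\mathrm{w}\Lambda)(t)=\Lambda(\mathrm{w}^{-1}t\mathrm{w})$. Every fixed point of $\theta$ has the form $\mathrm{w}H$ with $\mathrm{w}\in N_G(T)$, and the fixed points correspond to the cosets $W_G/W_H$. The multiset of weights at $eH$ is invariant under $W_H$ because $J$ is $G$-invariant. At a fixed point $gH$, the differentials $d\theta(t)$, $t\in T$, give a complex representation $d_g\theta$ of $T$ in $(T_{gH}(G/H),J)$, which splits into $n$ one-dimensional representations whose characters are its weights. *)

(* Defs.v *)
From HB Require Import structures.
From mathcomp Require Import all_boot all_order all_algebra.
From mathcomp Require Export perm complex.
From mathcomp Require Import all_classical all_reals all_analysis.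

Set Implicit Arguments.
Unset Strict Implicit.
Unset Printing Implicit Defensive.

Import Order.TTheory GRing.Theory Num.Theory.
Import numFieldNormedType.Exports.

Local Open Scope classical_set_scope.
Local Open Scope ring_scope.
Local Open Scope complex_scope.

#[short(type="groupTopologicalType")]
HB.structure Definition GroupTopological := {G of Group G & Topological G}.

Section Smooth.
Context {R : realType}.

(* All iterated directional derivatives exist and are differentiable at the
   points of U.  For U open and E, F finite-dimensional (the only case used
   below) this is C^infinity on U. *)
Definition smooth_on {E F : normedModType R} (U : set E) (f : E -> F) : Prop :=
  forall (s : seq E) (x : E), U x ->
    differentiable (foldr (fun v (h : E -> F) y => 'D_v h y) f s) x.

Record chart (M : topologicalType) (E : normedModType R) := Chart {
  cdom : set M;
  ccod : set E;
  cfwd : M -> E;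
  cbwd : E -> M;
  cdom_open : open cdom;
  ccod_open : open ccod;
  cfwd_in : forall x, cdom x -> ccod (cfwd x);
  cbwd_in : forall y, ccod y -> cdom (cbwd y);
  cfwdK : forall x, cdom x -> cbwd (cfwd x) = x;
  cbwdK : forall y, ccod y -> cfwd (cbwd y) = y;
  cfwd_continuous : forall x, cdom x -> {for x, continuous cfwd};
  cbwd_continuous : forall y, ccod y -> {for y, continuous cbwd} }.

Lemma open_setX {M N : topologicalType} (A : set M) (B : set N) :
  open A -> open B -> open (A `*` B).
Proof.
move=> oA oB; rewrite openE => -[x y] [/= Ax By].
by exists (A, B) => //; split; apply: open_nbhs_nbhs.
Qed.

Program Definition prod_chart {M N : topologicalType} {E F : normedModType R}
    (c : chart M E) (d : chart N F) : chart (M * N)%type (E * F)%type :=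
  @Chart (M * N)%type (E * F)%type
    (cdom c `*` cdom d) (ccod c `*` ccod d)
    (fun x => (cfwd c x.1, cfwd d x.2)) (fun y => (cbwd c y.1, cbwd d y.2))
    _ _ _ _ _ _ _ _.
Next Obligation. by move=> M N E F c d; apply: open_setX; exact: cdom_open. Qed.
Next Obligation. by move=> M N E F c d; apply: open_setX; exact: ccod_open. Qed.
Next Obligation.
by move=> M N E F c d [x y] [/= /cfwd_in ? /cfwd_in ?]; split.
Qed.
Next Obligation.
by move=> M N E F c d [x y] [/= /cbwd_in ? /cbwd_in ?]; split.
Qed.
Next Obligation. by move=> M N E F c d [x y] [/= /cfwdK -> /cfwdK ->]. Qed.
Next Obligation. by move=> M N E F c d [x y] [/= /cbwdK -> /cbwdK ->]. Qed.
Next Obligation.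
move=> M N E F c d [x y] [/= cx dy].
apply: cvg_pair.
  by apply: (cvg_comp fst (cfwd c)); [exact: cvg_fst|exact: cfwd_continuous].
by apply: (cvg_comp snd (cfwd d)); [exact: cvg_snd|exact: cfwd_continuous].
Qed.
Next Obligation.
move=> M N E F c d [x y] [/= cx dy].
apply: cvg_pair.
  by apply: (cvg_comp fst (cbwd c)); [exact: cvg_fst|exact: cbwd_continuous].
by apply: (cvg_comp snd (cbwd d)); [exact: cvg_snd|exact: cbwd_continuous].
Qed.

Definition smooth_atlas {M : topologicalType} {E : normedModType R}
    (A : set (chart M E)) : Prop :=
  (forall x, exists2 c, A c & cdom c x) /\
  (forall c d, A c -> A d ->
     smooth_on [set y | ccod c y /\ cdom d (cbwd c y)] (cfwd d \o cbwd c)).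

Definition smooth_manifold {M : topologicalType} {m : nat}
    (A : set (chart M 'rV[R]_m)) : Prop :=
  [/\ hausdorff_space M, @second_countable M & smooth_atlas A].

Definition prod_atlas {M N : topologicalType} {E F : normedModType R}
    (A : set (chart M E)) (B : set (chart N F)) :
    set (chart (M * N)%type (E * F)%type) :=
  [set e | exists c d, [/\ A c, B d & e = prod_chart c d]].

Definition smooth_map_on {M N : topologicalType} {E F : normedModType R}
    (W : set M) (A : set (chart M E)) (B : set (chart N F)) (f : M -> N) : Prop :=
  (forall x, W x -> {for x, continuous f}) /\
  (forall c d, A c -> B d ->
     smooth_on
       [set y | [/\ ccod c y, W (cbwd c y) & cdom d (f (cbwd c y))]]
       (cfwd d \o f \o cbwd c)).

Definition smooth_map {M N : topologicalType} {E F : normedModType R}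
    (A : set (chart M E)) (B : set (chart N F)) (f : M -> N) : Prop :=
  smooth_map_on setT A B f.

Definition smooth_fun {M : topologicalType} {E : normedModType R}
    (A : set (chart M E)) (f : M -> R) : Prop :=
  forall c, A c -> smooth_on (ccod c) (f \o cbwd c : E -> R^o).

(* Tangent vectors at p are the derivations at p of the algebra of smooth
   functions.  They are represented inside the vector space of all functionals
   (M -> R) -> R, by the value 0 on non-smooth functions, so that equality of
   tangent vectors is equality of functionals and the tangent spaces at all the
   points are subspaces of one ambient space. *)
Definition tangent {M : topologicalType} {E : normedModType R}
    (A : set (chart M E)) (p : M) : set ((M -> R) -> R^o) :=
  [set v | [/\ forall f, ~ smooth_fun A f -> v f = 0,
               forall (a : R) f g, smooth_fun A f -> smooth_fun A g ->
                 v (fun x => a * f x + g x) = a * v f + v g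
             & forall f g, smooth_fun A f -> smooth_fun A g ->
                 v (fun x => f x * g x) = f p * v g + g p * v f]].

(* The differential of f : M -> N, B being the atlas of N.  The point does not
   occur: if v is a tangent vector at p and f is smooth, then differential B f v
   is tangent at f p. *)
Definition differential {M N : topologicalType} {F : normedModType R}
    (B : set (chart N F)) (f : M -> N) (v : (M -> R) -> R^o) :
    (N -> R) -> R^o :=
  fun h => if `[< smooth_fun B h >] then v (h \o f) else 0.

Definition smooth_vector_field {M : topologicalType} {E : normedModType R}
    (A : set (chart M E)) (X : M -> (M -> R) -> R^o) : Prop :=
  (forall p, tangent A p (X p)) /\
  (forall f, smooth_fun A f -> smooth_fun A (fun p => X p f)).

Definition almost_complex_structure {M : topologicalType} {E : normedModType R}
    (A : set (chart M E))
    (J : M -> ((M -> R) -> R^o) -> ((M -> R) -> R^o)) : Prop :=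
  [/\ forall p v, tangent A p v -> tangent A p (J p v),
      forall p (a : R) u v, tangent A p u -> tangent A p v ->
        J p (a *: u + v) = a *: J p u + J p v,
      forall p v, tangent A p v -> J p (J p v) = - v
    & forall X, smooth_vector_field A X ->
        smooth_vector_field A (fun p => J p (X p))].

(* The action of complex scalars on the complex vector space (T_p M, J_p). *)
Definition cscale {M : topologicalType}
    (J : M -> ((M -> R) -> R^o) -> ((M -> R) -> R^o)) (p : M)
    (z : R[i]) (v : (M -> R) -> R^o) : (M -> R) -> R^o :=
  complex.Re z *: v + complex.Im z *: J p v.

Definition complex_basis {M : topologicalType} {E : normedModType R}
    (A : set (chart M E))
    (J : M -> ((M -> R) -> R^o) -> ((M -> R) -> R^o)) (p : M)
    (n : nat) (e : 'I_n -> (M -> R) -> R^o) : Prop :=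
  (forall i, tangent A p (e i)) /\
  (forall v, tangent A p v ->
     exists! z : 'rV[R[i]]_n, v = \sum_(i < n) cscale J p (z ord0 i) (e i)).

End Smooth.

Section Groups.
Context {R : realType} {G : groupTopologicalType}.
Local Open Scope group_scope.

Definition lie_group {m : nat} (A : set (chart G 'rV[R]_m)) : Prop :=
  [/\ smooth_manifold A,
      smooth_map (prod_atlas A A) A (fun x : G * G => x.1 * x.2)
    & smooth_map A A (fun x : G => x^-1)].

Definition is_subgroup (K : set G) : Prop :=
  [/\ K 1, forall x y, K x -> K y -> K (x * y) & forall x, K x -> K x^-1].

(* S is the image of (R/Z)^r under an injective continuous homomorphism.  As
   (R/Z)^r is compact, when G is Hausdorff this homomorphism is an isomorphism
   of topological groups of (R/Z)^r onto S, and S is closed. *)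
Definition is_torus (r : nat) (S : set G) : Prop :=
  exists phi : 'rV[R]_r -> G,
    [/\ continuous phi,
        forall x y, phi (x + y)%R = phi x * phi y,
        range phi = S
      & forall x, phi x = 1 <-> forall j, x ord0 j \is a Num.int].

Definition maximal_torus (K S : set G) : Prop :=
  [/\ exists r, is_torus r S, S `<=` K
    & forall r S', is_torus r S' -> S `<=` S' -> S' `<=` K -> S' = S].

Definition has_rank (K : set G) (r : nat) : Prop :=
  exists2 S, maximal_torus K S & is_torus r S.

Definition normalizer (S : set G) : set G :=
  [set w | [set w * t * w^-1 | t in S] = S].

Definition is_character (T : set G) (chi : G -> R[i]) : Prop :=
  [/\ forall s t, T s -> T t -> chi (s * t) = (chi s * chi t)%R,
      forall t, T t -> (`|chi t| = 1)%R,
      {within T, continuous (fun t => complex.Re (chi t) : R)}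
    & {within T, continuous (fun t => complex.Im (chi t) : R)}].

(* For T abelian and w in the normalizer of T, the restriction to T of a
   character transformed by w depends only on the class of w in N_G(T)/T. *)
Definition weyl_act (w : G) (chi : G -> R[i]) : G -> R[i] :=
  fun t => chi (w^-1 * t * w).

(* Equality, as multisets of characters of T, of two families indexed by 'I_n;
   only the values on T matter. *)
Definition same_weights (T : set G) (n : nat) (L L' : 'I_n -> G -> R[i]) : Prop :=
  exists s : {perm 'I_n}, forall i t, T t -> L' i t = L (s i) t.

End Groups.

Section Cosets.
Context {G : groupTopologicalType}.
Variable H : set G.
Local Open Scope group_scope.
Local Open Scope quotient_scope.

Definition lcoset (x : G) : set G := [set x * h | h in H].

Definition same_coset (x y : G) : bool := `[< lcoset x = lcoset y >].

Lemma same_coset_refl : reflexive same_coset.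
Proof. by move=> x; apply/asboolP. Qed.

Lemma same_coset_sym : symmetric same_coset.
Proof. by move=> x y; apply/asboolP/asboolP. Qed.

Lemma same_coset_trans : transitive same_coset.
Proof. by move=> y x z /asboolP xy /asboolP yz; apply/asboolP; rewrite xy. Qed.

Definition same_coset_equiv : equiv_rel G :=
  EquivRel same_coset same_coset_refl same_coset_sym same_coset_trans.

Definition coset_space : topologicalType :=
  quotient_topology {eq_quot same_coset_equiv}.

Definition coset_proj (x : G) : coset_space :=
  \pi_({eq_quot same_coset_equiv}) x.

Lemma coset_projP (x y : G) : coset_proj x = coset_proj y <-> lcoset x = lcoset y.
Proof.
split=> [/eqquotP /asboolP //|xy].
by apply/eqquotP; apply/asboolP.
Qed.

Definition coset_act (g : G) (p : coset_space) : coset_space :=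
  coset_proj (g * repr (p : {eq_quot same_coset_equiv})).

Lemma coset_act_proj (g x : G) : coset_act g (coset_proj x) = coset_proj (g * x).
Proof.
apply/coset_projP.
have /coset_projP E : coset_proj (repr (coset_proj x : {eq_quot same_coset_equiv}))
  = coset_proj x by rewrite /coset_proj reprK.
have lcosetM y z : lcoset (y * z) = [set y * u | u in lcoset z].
  rewrite /lcoset; apply/seteqP; split=> [_ [h Hh <-]|_ [_ [h Hh <-] <-]].
    by exists (z * h); [exists h|rewrite mulgA].
  by exists h => //; rewrite mulgA.
by rewrite !lcosetM E.
Qed.

End Cosets.

Section Homogeneous.
Context {R : realType} {G : groupTopologicalType}.

(* The manifold structure of G/H: it is the unique one for which the projection
   is smooth and has smooth local sections. *)
Definition homogeneous_structure {m k : nat} (A : set (chart G 'rV[R]_m))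
    (H : set G) (B : set (chart (coset_space H) 'rV[R]_k)) : Prop :=
  [/\ smooth_manifold B,
      smooth_map A B (coset_proj H)
    & forall p : coset_space H, exists W (s : coset_space H -> G),
        [/\ open W, W p, smooth_map_on W B A s
          & forall x, W x -> coset_proj H (s x) = x]].

Definition invariant_structure {k : nat} (H : set G)
    (B : set (chart (coset_space H) 'rV[R]_k))
    (J : coset_space H -> ((coset_space H -> R) -> R^o) ->
         ((coset_space H -> R) -> R^o)) : Prop :=
  forall (g : G) p v, tangent B p v ->
    differential B (coset_act g) (J p v) =
    J (coset_act g p) (differential B (coset_act g) v).

Definition fixed_point (H T : set G) (p : coset_space H) : Prop :=
  forall t, T t -> coset_act t p = p.

(* L lists, with multiplicity, the weights of the complex representation
   t |-> d theta(t) of T on (T_p(G/H), J_p), p being a fixed point. *)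
Definition weights_at {k : nat} (H T : set G)
    (B : set (chart (coset_space H) 'rV[R]_k))
    (J : coset_space H -> ((coset_space H -> R) -> R^o) ->
         ((coset_space H -> R) -> R^o))
    (p : coset_space H) (n : nat) (L : 'I_n -> G -> R[i]) : Prop :=
  (forall i, is_character T (L i)) /\
  exists2 e : 'I_n -> (coset_space H -> R) -> R^o,
    complex_basis B J p e
  & forall i t, T t ->
      differential B (coset_act t) (e i) = cscale J p (L i t) (e i).

End Homogeneous.

(* Main.v *)
(** Translation by w maps eH to wH; its differential commutes with J, and
    t w = w (w^-1 t w) turns an eigenbasis of T at eH with characters L_i into
    an eigenbasis at wH with characters w(L_i).  Two eigenbases at one fixed
    point are related by an invertible matrix P with L'_i P_ij = P_ij L_j; a
    nonzero term of the Leibniz expansion of det P is a permutation matching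
    the two families of weights.  The W_H-invariance of the weights at eH is
    the case w in H of these two facts.

    The functions smooth on G/H are preserved by translations because a
    translation is locally the composition of a smooth section, a left
    translation of G and the projection. *)

Require Import Defs.
From HB Require Import structures.
From mathcomp Require Import all_boot all_order all_algebra.
From mathcomp Require Import perm complex.
From mathcomp Require Import ring.
From mathcomp Require Import all_classical all_reals all_analysis.

Set Implicit Arguments.
Unset Strict Implicit.
Unset Printing Implicit Defensive.

Import Order.TTheory GRing.Theory Num.Theory.
Import numFieldNormedType.Exports.

Local Open Scope classical_set_scope.
Local Open Scope ring_scope.
Local Open Scope complex_scope.

(* [diffn n] says that the directional derivatives of order at most n exist
   and are differentiable.  Unlike for [smooth_on], the closure properties can
   be proved by induction on n. *)
Fixpoint diffn {R : realType} {E F : normedModType R} (n : nat) (U : set E)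
    (f : E -> F) : Prop :=
  (forall x, U x -> differentiable f x) /\
  (if n is n'.+1 then forall v, diffn n' U (fun x => 'D_v f x) else True).

(** * Closure properties of differentiability to finite order *)

Section Calculus.
Context {R : realType}.
Implicit Types E F : normedModType R.

(** [foldr] applies the last direction first, so the innermost derivative is split off at the right
    end of the list. This matches the recursion of [diffn]. *)
Lemma foldr_derive_rcons E F (s : seq E) v (f : E -> F) :
  foldr (fun v (h : E -> F) y => 'D_v h y) f (rcons s v) =
  foldr (fun v (h : E -> F) y => 'D_v h y) (fun y => 'D_v f y) s.
Proof. by rewrite -cats1 foldr_cat. Qed.

Lemma smooth_onP E F (U : set E) (f : E -> F) :
  smooth_on U f <-> forall n, diffn n U f.
Proof.
split=> [sf n|df s x Ux].
  elim: n f sf => [|n IH] f sf; split=> //; try exact: (sf [::]).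
  move=> v; apply: IH => s x Ux; rewrite -foldr_derive_rcons; exact: sf.
move: (df (size s)); elim/last_ind: s f {df} => [|s v IH] f.
  by case=> + _; exact.
by rewrite size_rcons => -[_ /(_ v)]; rewrite foldr_derive_rcons; exact: IH.
Qed.

Lemma diffnW E F n (U : set E) (f : E -> F) : diffn n.+1 U f -> diffn n U f.
Proof.
elim: n f => [|n IH] f [df Df]; split=> // v; exact/IH/Df.
Qed.

(** The first-order expansion of f at x only involves values near x, so it is also one for g;
    uniqueness of the linear part then identifies the differential of g. *)
Lemma near_eq_differentiable E F (f g : E -> F) x :
  (\near x, f x = g x) -> differentiable f x -> differentiable g x.
Proof.
move=> fg df; have gx : f x = g x by exact: nbhs_singleton fg.
have dg : g \o shift x = cst (g x) + 'd f x +o_ 0 id.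
  apply/eqaddoP => e e0.
  have /diff_locally /eqaddoP /(_ e e0) dfe := df.
  have fg0 : \forall y \near (0 : E), f (y + x) = g (y + x).
    have : (y + x) @[y --> (0 : E)] --> x.
      by rewrite -{2}[x]add0r; apply: cvgD; [exact: cvg_id|exact: cvg_cst].
    by move=> /(_ _ fg).
  near=> y.
  have -> : (g \o shift x - (cst (g x) + 'd f x)) y =
      (f \o shift x - (cst (f x) + 'd f x)) y.
    rewrite !fctE /= gx; congr (_ - _); apply/esym; near: y; exact: fg0.
  by near: y.
have dgf := diff_unique (@diff_continuous _ _ _ _ _ df) dg.
by apply/diff_locallyP; rewrite dgf; split=> //; exact: diff_continuous.
Unshelve. all: by end_near. Qed.

(** On an open set, pointwise agreement is agreement near each point, hence it passes to the
    derivatives and the induction goes on. *)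
Lemma diffn_eq E F n (U : set E) (f g : E -> F) :
  open U -> (forall x, U x -> f x = g x) -> diffn n U f -> diffn n U g.
Proof.
move=> oU; elim: n f g => [|n IH] f g fg [df Df].
  split=> // x Ux; apply: near_eq_differentiable (df x Ux).
  by apply: filterS (open_nbhs_nbhs (conj oU Ux)) => y /fg.
split=> [x Ux|v].
  apply: near_eq_differentiable (df x Ux).
  by apply: filterS (open_nbhs_nbhs (conj oU Ux)) => y /fg.
apply: IH (Df v) => x Ux; apply: near_eq_derive.
by apply: filterS (open_nbhs_nbhs (conj oU Ux)) => y /fg.
Qed.

Lemma diffn_cst E F n (U : set E) (c : F) : diffn n U (fun _ : E => c).
Proof.
elim: n c => [|n IH] c; split=> //; try by move=> x _; exact: differentiable_cst.
move=> v; under eq_fun do rewrite derive_cst; exact: IH.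
Qed.

Lemma diffnD E F n (U : set E) (f g : E -> F) : open U ->
  diffn n U f -> diffn n U g -> diffn n U (fun x => f x + g x).
Proof.
move=> oU; elim: n f g => [|n IH] f g [df Df] [dg Dg]; split=> //;
  try by move=> x Ux; apply: differentiableD; [exact: df|exact: dg].
move=> v; apply: diffn_eq (IH _ _ (Df v) (Dg v)) => // x Ux.
by rewrite -deriveD//; apply: diff_derivable; [exact: df|exact: dg].
Qed.

Lemma diffnM E n (U : set E) (f g : E -> R^o) : open U ->
  diffn n U f -> diffn n U g -> diffn n U (fun x => f x * g x : R^o).
Proof.
move=> oU; elim: n f g => [|n IH] f g df dg; split=> //.
1,2: by move=> x Ux; apply: differentiableM; [exact: df.1|exact: dg.1].
move=> v.
(* The product rule mixes f and g with their derivatives, so the induction hypothesis is also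
   applied to f and g themselves, one order lower. *)
apply: (@diffn_eq _ _ _ _ (fun x => f x * 'D_v g x + g x * 'D_v f x)) => //.
  move=> x Ux; rewrite -deriveM//; apply: diff_derivable.
    exact: df.1.
  exact: dg.1.
have [fn gn] := (diffnW df, diffnW dg).
by apply: diffnD => //; apply: IH => //; [exact: dg.2|exact: df.2].
Qed.

Lemma diffn_sum E F n k (U : set E) (f : 'I_k -> E -> F) : open U ->
  (forall i, diffn n U (f i)) -> diffn n U (fun x => \sum_(i < k) f i x).
Proof.
move=> oU; elim: k f => [|k IH] f df.
  by under eq_fun do rewrite big_ord0; exact: diffn_cst.
under eq_fun do rewrite big_ord_recl.
by apply: diffnD => //; apply: IH.
Qed.

Lemma diffn_coord E n k (U : set E) (f : E -> 'rV[R]_k) (j : 'I_k) : open U ->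
  diffn n U f -> diffn n U (fun x => f x ord0 j : R^o).
Proof.
move=> oU.
have dcoord (h : E -> 'rV[R]_k) x : differentiable h x ->
    differentiable (fun y => h y ord0 j : R^o) x.
  move=> dh; apply: (@differentiable_comp _ _ _ _ h
    (fun N : 'rV[R]_k => N ord0 j : R^o)) => //.
  exact: differentiable_coord.
elim: n f => [|n IH] f df; split=> //;
  try by move=> x Ux; apply: dcoord; exact: df.1.
move=> v; apply: diffn_eq (IH _ (df.2 v)) => // x Ux.
rewrite derive_mx ?mxE//; apply: diff_derivable; exact: df.1.
Qed.

(* Stated for scalar-valued f only: the induction uses the chain rule
   D_v (f o g) = \sum_j (D_v g)_j (D_j f o g) and [diffnM]. *)
Lemma diffn_comp E k n (U : set E) (V : set 'rV[R]_k)
    (g : E -> 'rV[R]_k) (f : 'rV[R]_k -> R^o) :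
  open U -> (forall x, U x -> V (g x)) ->
  diffn n V f -> diffn n U g -> diffn n U (f \o g).
Proof.
move=> oU UV; elim: n f => [|n IH] f df dg.
  split=> // x Ux; apply: differentiable_comp; first exact: dg.1.
  exact/df.1/UV.
split=> [x Ux|v].
  apply: differentiable_comp; first exact: dg.1.
  exact/df.1/UV.
apply: (@diffn_eq _ _ _ _ (fun x => \sum_(j < k)
    (('D_v g x) ord0 j * ('D_(delta_mx ord0 j) f \o g) x) : R^o)) => //.
  move=> x Ux; have dgx := dg.1 x Ux; have dfx := df.1 _ (UV x Ux).
  have -> : 'D_v (f \o g) x = 'd f (g x) ('D_v g x).
    rewrite (deriveE v (differentiable_comp dgx dfx)) (deriveE v dgx).
    by rewrite (diff_comp dgx dfx).
  rewrite [in RHS](row_sum_delta ('D_v g x)) linear_sum; apply: eq_bigr => j _.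
  by rewrite linearZ /= -(deriveE (delta_mx ord0 j) dfx).
apply: diffn_sum => // j; apply: diffnM => //.
  by apply: diffn_coord => //; exact: dg.2.
by apply: IH; [exact: df.2|exact: diffnW].
Qed.

End Calculus.

(** * Smooth maps between normed spaces *)

Section SmoothOn.
Context {R : realType}.
Implicit Types E F : normedModType R.

Lemma smooth_on_sub E F (U V : set E) (f : E -> F) :
  U `<=` V -> smooth_on V f -> smooth_on U f.
Proof. by move=> UV sf s x /UV; exact: sf. Qed.

(** The functions are total and derivatives are taken in the whole space, so the set only selects
    the points at which the condition is required. *)
Lemma smooth_on_local E F (U : set E) (f : E -> F) :
  (forall x, U x -> exists2 V, V x & smooth_on V f) -> smooth_on U f.
Proof. by move=> locf s x /locf[V Vx]; exact. Qed.

Lemma smooth_on_eq E F (U : set E) (f g : E -> F) :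
  open U -> (forall x, U x -> f x = g x) -> smooth_on U f -> smooth_on U g.
Proof.
by move=> oU fg /smooth_onP sf; apply/smooth_onP => n; exact: diffn_eq (sf n).
Qed.

Lemma smooth_onD E F (U : set E) (f g : E -> F) : open U ->
  smooth_on U f -> smooth_on U g -> smooth_on U (fun x => f x + g x).
Proof.
move=> oU /smooth_onP sf /smooth_onP sg; apply/smooth_onP => n.
exact: diffnD.
Qed.

Lemma smooth_on_cst E F (U : set E) (c : F) : smooth_on U (fun _ : E => c).
Proof. by apply/smooth_onP => n; exact: diffn_cst. Qed.

Lemma smooth_onM E (U : set E) (f g : E -> R^o) : open U ->
  smooth_on U f -> smooth_on U g -> smooth_on U (fun x => f x * g x : R^o).
Proof.
move=> oU /smooth_onP sf /smooth_onP sg; apply/smooth_onP => n.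
exact: diffnM.
Qed.

Lemma smooth_on_comp E k (U : set E) (V : set 'rV[R]_k)
    (g : E -> 'rV[R]_k) (f : 'rV[R]_k -> R^o) :
  open U -> (forall x, U x -> V (g x)) ->
  smooth_on V f -> smooth_on U g -> smooth_on U (f \o g).
Proof.
move=> oU UV /smooth_onP sf /smooth_onP sg; apply/smooth_onP => n.
exact: diffn_comp (sf n) (sg n).
Qed.

(** A derivative of the slice in direction v is the derivative of f in direction (0, v). *)
Lemma smooth_on_slice E E' F (U : set (E * E')) (f : E * E' -> F) (a : E) :
  smooth_on U f -> smooth_on [set y | U (a, y)] (fun y => f (a, y)).
Proof.
move=> sf s y Uy.
have -> : foldr (fun v (h : E' -> F) y => 'D_v h y) (fun y => f (a, y)) s =
    (fun y => foldr (fun v (h : E * E' -> F) y => 'D_v h y) f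
                    [seq (0, v) | v <- s] (a, y)).
  elim: s => //= v s ->; apply/funext => z; rewrite /derive.
  suff shiftE (h : R) : (a, h *: v + z) = h *: (0, v) + (a, z) :> E * E'.
    by under eq_fun do rewrite /= shiftE.
  by apply: injective_projections => /=; rewrite ?scaler0 ?add0r.
apply: (@differentiable_comp _ _ _ _ (fun y => (a, y))).
  apply: (@differentiable_pair _ _ _ _ (cst a) id) => //.
exact: sf.
Qed.

End SmoothOn.

(** * The algebra of smooth functions and pullback *)

Section SmoothFun.
Context {R : realType} {M : topologicalType} {E : normedModType R}.
Implicit Types (A : set (chart M E)) (f g : M -> R).

Lemma open_chart_preimage (c : chart M E) (W : set M) :
  open W -> open [set y | ccod c y /\ W (cbwd c y)].
Proof.
move=> oW; rewrite openE => y [cy Wy].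
near=> z; split; near: z.
  exact: open_nbhs_nbhs (conj (ccod_open c) cy).
exact: (cbwd_continuous cy (open_nbhs_nbhs (conj oW Wy))).
Unshelve. all: by end_near. Qed.

Lemma smooth_fun_lin A (a : R) f g : smooth_fun A f -> smooth_fun A g ->
  smooth_fun A (fun x => a * f x + g x).
Proof.
move=> sf sg c Ac; have oc := ccod_open c.
apply: (@smooth_onD _ _ R^o) (sg c Ac) => //.
by apply: smooth_onM (sf c Ac) => //; exact: smooth_on_cst.
Qed.

Lemma smooth_funM A f g : smooth_fun A f -> smooth_fun A g ->
  smooth_fun A (fun x => f x * g x).
Proof.
by move=> sf sg c Ac; apply: smooth_onM (sf c Ac) (sg c Ac); exact: ccod_open.
Qed.

(** The open set [W] allows for maps that are smooth only locally, such as the local sections of the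
    projection onto G/H. *)
Lemma smooth_fun_comp_on A {N : topologicalType} {k : nat}
    (B : set (chart N 'rV[R]_k)) (W : set M) (phi : M -> N) (f : N -> R) :
  smooth_atlas B -> open W -> smooth_map_on W A B phi -> smooth_fun B f ->
  forall c, A c ->
  smooth_on [set y | ccod c y /\ W (cbwd c y)] (f \o phi \o cbwd c : E -> R^o).
Proof.
move=> [Bcov _] oW [cphi sphi] sf c Ac; apply: smooth_on_local => y [cy Wy].
have [d Bd dy] := Bcov (phi (cbwd c y)).
exists [set y | [/\ ccod c y, W (cbwd c y) & cdom d (phi (cbwd c y))]] => //.
have oU : open [set y | [/\ ccod c y, W (cbwd c y) & cdom d (phi (cbwd c y))]].
  rewrite (_ : mkset _ =
      [set y | ccod c y /\ (W `&` phi @^-1` cdom d) (cbwd c y)]).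
    apply: open_chart_preimage; rewrite openE => x [Wx dx].
    near=> z; split; near: z.
      exact: open_nbhs_nbhs.
    by apply: (cphi x Wx); exact: open_nbhs_nbhs (conj (cdom_open d) dx).
  by apply/seteqP; split=> z /=; [case=> ? ? ?|case=> ? []].
(* Inserting a chart d around the image point factors the map through a finite-dimensional space,
   where the chain rule applies. *)
apply: (@smooth_on_eq _ _ _ _
  ((f \o cbwd d) \o (cfwd d \o phi \o cbwd c))) => //.
  by move=> z [_ _ dz] /=; rewrite cfwdK.
apply: smooth_on_comp (sf d Bd) (sphi c d Ac Bd) => //.
by move=> z [_ _ /cfwd_in].
Unshelve. all: by end_near. Qed.

Lemma smooth_fun_comp A {N : topologicalType} {k : nat}
    (B : set (chart N 'rV[R]_k)) (phi : M -> N) (f : N -> R) :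
  smooth_atlas B -> smooth_map A B phi -> smooth_fun B f ->
  smooth_fun A (f \o phi).
Proof.
move=> Bat sphi sf c Ac.
apply: smooth_on_sub (smooth_fun_comp_on Bat openT sphi sf Ac).
by move=> y cy; split.
Qed.

End SmoothFun.

(** * Tangent spaces and differentials *)

Section TangentPush.
Context {R : realType} {M : topologicalType} {E : normedModType R}.
Context {A : set (chart M E)}.

Lemma tangent0 p : tangent A p 0.
Proof. by split=> *; rewrite /= ?fctE ?mulr0 ?addr0. Qed.

Lemma tangent_lin p (a : R) u v : tangent A p u -> tangent A p v ->
  tangent A p (a *: u + v).
Proof.
move=> [u0 uL uM] [v0 vL vM]; split.
- by move=> f nf; rewrite !fctE u0// v0// scaler0 addr0.
- by move=> b f g sf sg; rewrite !fctE uL// vL// /GRing.scale/=; ring.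
- by move=> f g sf sg; rewrite !fctE uM// vM// /GRing.scale/=; ring.
Qed.

(** Smoothness of [phi] enters only as preservation of smooth functions under pullback, which is the
    form in which it is obtained for translations of G/H. *)
Lemma tangent_differential (phi : M -> M) p v :
  (forall f, smooth_fun A f -> smooth_fun A (f \o phi)) ->
  tangent A p v -> tangent A (phi p) (differential A phi v).
Proof.
move=> sphi [v0 vL vM]; rewrite /differential; split.
- by move=> f nsf; case: asboolP.
- move=> a f g sf sg; rewrite !asboolT//; last exact: smooth_fun_lin.
  by rewrite -vL//; exact: sphi.
- move=> f g sf sg; rewrite !asboolT//; last exact: smooth_funM.
  by rewrite -vM//; exact: sphi.
Qed.

Lemma differential_comp (phi psi : M -> M) v :
  (forall f, smooth_fun A f -> smooth_fun A (f \o phi)) ->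
  differential A phi (differential A psi v) = differential A (phi \o psi) v.
Proof.
move=> sphi; apply/funext => f; rewrite /differential; case: asboolP => // sf.
by rewrite asboolT//; exact: sphi.
Qed.

(** Tangency matters here: v must vanish on non-smooth functions, where the differential is 0 by
    convention. *)
Lemma differential_id p v : tangent A p v -> differential A id v = v.
Proof.
move=> [v0 _ _]; apply/funext => f; rewrite /differential.
by case: asboolP => // /v0.
Qed.

Lemma differential_lin (phi : M -> M) (a : R) u v :
  differential A phi (a *: u + v) =
  a *: differential A phi u + differential A phi v.
Proof.
apply/funext => f; rewrite /differential !fctE; case: asboolP => // _.
by rewrite scaler0 addr0.
Qed.

Lemma differential0 (phi : M -> M) : differential A phi 0 = 0.
Proof. by apply/funext => f; rewrite /differential; case: asboolP. Qed.

Lemma differential_sum (phi : M -> M) n (v : 'I_n -> (M -> R) -> R^o) :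
  differential A phi (\sum_(i < n) v i) = \sum_(i < n) differential A phi (v i).
Proof.
elim: n v => [|n IH] v; first by rewrite !big_ord0 differential0.
by rewrite !big_ord_recl -IH -[v ord0]scale1r differential_lin !scale1r.
Qed.

End TangentPush.

(** * Continuity of products and smoothness of left translations *)

Section LieGroup.
Context {R : realType} {G : groupTopologicalType} {m : nat}.
Context {A : set (chart G 'rV[R]_m)} (G_lie : lie_group A).

Lemma lie_mul_continuous (x y : G) :
  {for (x, y), continuous (fun z : G * G => (z.1 * z.2)%g)}.
Proof. by case: G_lie => _ [+ _] _; exact. Qed.

Lemma lie_mul_cvg {T : Type} (F : set_system T) {FF : Filter F}
    (u v : T -> G) (x y : G) :
  u @ F --> x -> v @ F --> y -> (fun t => (u t * v t)%g) @ F --> (x * y)%g.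
Proof.
move=> ux vy.
apply: (cvg_comp (fun t => (u t, v t)) (fun z : G * G => (z.1 * z.2)%g)).
  exact: cvg_pair ux vy.
exact: lie_mul_continuous.
Qed.

Lemma smooth_left_mul (g : G) : smooth_map A A (fun x => (g * x)%g).
Proof.
case: G_lie => -[_ _ [Acov _]] [_ smul] _; split.
  by move=> x _; apply: lie_mul_cvg; [exact: cvg_cst|exact: cvg_id].
move=> c d Ac Ad; have [e Ae eg] := Acov g.
have Aec : prod_atlas A A (prod_chart e c) by exists e, c.
(* Left translation by g is multiplication with the first factor frozen, that is, a slice of the
   product chart at the coordinates of g. *)
have sslice := @smooth_on_slice _ _ _ _ _ _ (cfwd e g) (smul _ _ Aec Ad).
have -> : cfwd d \o (fun x : G => (g * x)%g) \o cbwd c =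
  (fun y => (cfwd d \o (fun x : G * G => (x.1 * x.2)%g)
             \o cbwd (prod_chart e c))
     (cfwd e g, y)).
  by apply/funext => y /=; rewrite cfwdK.
apply: smooth_on_sub sslice => y [cy _ dy].
by split=> //=; [split=> //; exact: cfwd_in|rewrite cfwdK].
Qed.

End LieGroup.

(** * Complex linear algebra in the tangent space with J *)

Section ComplexTangent.
Context {R : realType} {M : topologicalType} {E : normedModType R}.
Context {A : set (chart M E)}.
Context {J : M -> ((M -> R) -> R^o) -> ((M -> R) -> R^o)}.
Context (J_almost_complex : almost_complex_structure A J) (p : M).
Implicit Types (u v : (M -> R) -> R^o) (z : R[i]).

Lemma tangentJ v : tangent A p v -> tangent A p (J p v).
Proof. by case: J_almost_complex => + _ _ _; exact. Qed.

Lemma J_lin (a : R) u v : tangent A p u -> tangent A p v ->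
  J p (a *: u + v) = a *: J p u + J p v.
Proof. by case: J_almost_complex => _ + _ _; exact. Qed.

Lemma JJ v : tangent A p v -> J p (J p v) = - v.
Proof. by case: J_almost_complex => _ _ + _; exact. Qed.

Lemma J0 : J p 0 = 0.
Proof.
have := J_lin 1 (tangent0 p) (tangent0 p).
by rewrite !scale1r addr0 -{1}[J p 0]addr0 => /addrI.
Qed.

Lemma tangentD u v : tangent A p u -> tangent A p v -> tangent A p (u + v).
Proof. by move=> tu tv; rewrite -[u]scale1r; exact: tangent_lin. Qed.

Lemma tangentZ (a : R) v : tangent A p v -> tangent A p (a *: v).
Proof.
move=> tv; rewrite -[_ *: v]addr0.
by apply: tangent_lin => //; exact: tangent0.
Qed.

Lemma JD u v : tangent A p u -> tangent A p v -> J p (u + v) = J p u + J p v.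
Proof. by move=> tu tv; rewrite -[u in LHS]scale1r J_lin// scale1r. Qed.

Lemma JZ (a : R) v : tangent A p v -> J p (a *: v) = a *: J p v.
Proof.
by move=> tv; rewrite -[a *: v]addr0 J_lin//; [rewrite J0 addr0|exact: tangent0].
Qed.

Lemma cscale_tangent z v : tangent A p v -> tangent A p (Defs.cscale J p z v).
Proof.
move=> tv; apply: tangentD; apply: tangentZ => //; exact: tangentJ.
Qed.

Lemma cscaleDl z z' v :
  Defs.cscale J p (z + z') v = Defs.cscale J p z v + Defs.cscale J p z' v.
Proof.
case: z z' => [a b] [c d]; rewrite /Defs.cscale/=; apply/funext => f.
rewrite !fctE /GRing.scale /=; ring.
Qed.

Lemma cscaleDr z u v : tangent A p u -> tangent A p v ->
  Defs.cscale J p z (u + v) = Defs.cscale J p z u + Defs.cscale J p z v.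
Proof.
by move=> tu tv; rewrite /Defs.cscale JD// !scalerDr addrACA.
Qed.

(** This is the product (a + bJ)(c + dJ) expanded with J^2 = -1. *)
Lemma cscaleA z z' v : tangent A p v ->
  Defs.cscale J p z (Defs.cscale J p z' v) = Defs.cscale J p (z * z') v.
Proof.
move=> tv; have tJv := tangentJ tv.
case: z z' => [a b] [c d]; rewrite /Defs.cscale/= JD; try exact: tangentZ.
rewrite !JZ// JJ//; apply/funext => f; rewrite !fctE /GRing.scale /=; ring.
Qed.

Lemma cscale0l v : Defs.cscale J p 0 v = 0.
Proof. by rewrite /Defs.cscale /= !scale0r addr0. Qed.

Lemma cscale0r z : Defs.cscale J p z 0 = 0.
Proof. by rewrite /Defs.cscale J0 !scaler0 addr0. Qed.

Lemma cscale1 v : Defs.cscale J p 1 v = v.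
Proof. by rewrite /Defs.cscale /= scale0r addr0 scale1r. Qed.

Lemma tangent_sum n (v : 'I_n -> (M -> R) -> R^o) :
  (forall i, tangent A p (v i)) -> tangent A p (\sum_(i < n) v i).
Proof.
by move=> tv; apply: big_ind => //; [exact: tangent0|exact: tangentD].
Qed.

Lemma cscale_sumr n z (v : 'I_n -> (M -> R) -> R^o) :
  (forall i, tangent A p (v i)) ->
  Defs.cscale J p z (\sum_(i < n) v i) = \sum_(i < n) Defs.cscale J p z (v i).
Proof.
elim: n v => [|n IH] v tv; first by rewrite !big_ord0 cscale0r.
rewrite !big_ord_recl cscaleDr// ?IH// => *; exact: tangent_sum.
Qed.

Lemma cscale_suml n (z : 'I_n -> R[i]) v :
  Defs.cscale J p (\sum_(i < n) z i) v = \sum_(i < n) Defs.cscale J p (z i) v.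
Proof.
elim: n z => [|n IH] z; first by rewrite !big_ord0 cscale0l.
by rewrite !big_ord_recl cscaleDl IH.
Qed.

(** The uniqueness half of the basis property: both families are coordinates of one tangent
    vector. *)
Lemma complex_basis_inj n (e : 'I_n -> (M -> R) -> R^o) (x y : 'I_n -> R[i]) :
  complex_basis A J p e ->
  \sum_(i < n) Defs.cscale J p (x i) (e i) =
    \sum_(i < n) Defs.cscale J p (y i) (e i) ->
  x =1 y.
Proof.
move=> [te be] exy i.
have /be[z [_ zP]] : tangent A p (\sum_(i < n) Defs.cscale J p (x i) (e i)).
  by apply: tangent_sum => j; exact: cscale_tangent.
have zx : z = \row_j x j by apply: zP; apply: eq_bigr => j _; rewrite mxE.
have zy : z = \row_j y j.
  by apply: zP; rewrite exy; apply: eq_bigr => j _; rewrite mxE.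
by have /rowP/(_ i) := etrans (esym zx) zy; rewrite !mxE.
Qed.

(** The existence half of the basis property, with the chosen coordinates of [e' i] as row i of
    P. *)
Lemma complex_basis_expand n n' (e : 'I_n -> (M -> R) -> R^o)
    (e' : 'I_n' -> (M -> R) -> R^o) :
  complex_basis A J p e -> (forall i, tangent A p (e' i)) ->
  exists P : 'M[R[i]]_(n', n),
    forall i, e' i = \sum_(j < n) Defs.cscale J p (P i j) (e j).
Proof.
move=> [_ be] te'.
have /choice[f fP] (i : 'I_n') : exists r : 'rV[R[i]]_n,
    e' i = \sum_(j < n) Defs.cscale J p (r ord0 j) (e j).
  by have [z [zP _]] := be _ (te' i); exists z.
exists (\matrix_(i, j) f i ord0 j) => i.
by rewrite {1}fP; apply: eq_bigr => j _; rewrite mxE.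
Qed.

End ComplexTangent.

(** * Invertible matrices and conjugation by the normalizer *)

Lemma unitmx_support (F : fieldType) n (P : 'M[F]_n) : P \in unitmx ->
  exists s : {perm 'I_n}, forall i, P i (s i) != 0.
Proof.
rewrite unitmxE unitfE => detP.
have [s /prodf_neq0 sP|P0] := pickP
  (fun s : {perm 'I_n} => \prod_i P i (s i) != 0).
  by exists s => i; exact: sP.
move: detP; rewrite /determinant big1 ?eqxx// => s _.
by have /negbFE/eqP -> := P0 s; rewrite mulr0.
Qed.

Lemma normalizer_conj (G : groupTopologicalType) (T : set G) (w t : G) :
  normalizer T w -> T t -> T (w^-1 * t * w)%g.
Proof.
move=> wT; rewrite -{1}wT => -[s Ts <-].
by rewrite !mulgA mulVg mul1g -mulgA mulVg mulg1.
Qed.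

(** * Translations of G/H and weights at fixed points *)

Section Homogeneous.
Context {R : realType} {G : groupTopologicalType} {m k : nat}.
Context {A : set (chart G 'rV[R]_m)} {H : set G}.
Context {B : set (chart (coset_space H) 'rV[R]_k)}.
Context {J : coset_space H -> ((coset_space H -> R) -> R^o) ->
         ((coset_space H -> R) -> R^o)}.
Context (G_lie : lie_group A) (B_homogeneous : homogeneous_structure A B).
Context (J_almost_complex : almost_complex_structure B J).
Context (J_invariant : invariant_structure B J).

Lemma coset_proj_surj (p : coset_space H) : exists x, p = coset_proj H x.
Proof.
exists (repr (p : {eq_quot same_coset_equiv H}%qT)).
by rewrite /coset_proj reprK.
Qed.

Lemma coset_act_mul (x y : G) :
  coset_act x \o coset_act y = coset_act (x * y)%g :> (coset_space H -> _).
Proof.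
apply/funext => p /=; have [z ->] := coset_proj_surj p.
by rewrite !coset_act_proj mulgA.
Qed.

Lemma coset_act1 : coset_act 1%g = id :> (coset_space H -> _).
Proof.
apply/funext => p; have [z ->] := coset_proj_surj p.
by rewrite coset_act_proj mul1g.
Qed.

Lemma smooth_coset_act (x : G) f :
  smooth_fun B f -> smooth_fun B (f \o coset_act x).
Proof.
case: B_homogeneous => [[_ _ Bat] sproj sec] sf.
have [[_ _ Aat] _ _] := G_lie.
(* The lift to G of the translated function: it is f on the coset of x y, hence smooth as a
   composition of smooth maps. *)
have sfx : smooth_fun A (f \o coset_proj H \o (fun y => (x * y)%g)).
  apply: smooth_fun_comp (smooth_left_mul G_lie x) _ => //.
  exact: smooth_fun_comp sproj sf.
move=> c Bc; apply: smooth_on_local => y cy.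
have [W [s [oW Wy ss sK]]] := sec (cbwd c y).
exists [set y | ccod c y /\ W (cbwd c y)] => //.
apply: (smooth_on_eq _ _ (smooth_fun_comp_on Aat oW ss sfx Bc)).
  exact: open_chart_preimage.
(* On [W] the section s recovers the translated function from its lift. *)
by move=> z [_ Wz] /=; rewrite -[in RHS](sK _ Wz) coset_act_proj.
Qed.

Lemma tangent_coset_act (x : G) p v : tangent B p v ->
  tangent B (coset_act x p) (differential B (coset_act x) v).
Proof. by apply: tangent_differential => f; exact: smooth_coset_act. Qed.

Lemma differential_coset_act_mul (x y : G) v :
  differential B (coset_act x) (differential B (coset_act y) v) =
  differential B (coset_act (x * y)%g) v.
Proof.
by rewrite differential_comp ?coset_act_mul// => f; exact: smooth_coset_act.
Qed.

Lemma differential_coset_act1 p v : tangent B p v ->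
  differential B (coset_act 1%g) v = v.
Proof. by rewrite coset_act1; exact: differential_id. Qed.

Lemma differential_cscale (x : G) p z v : tangent B p v ->
  differential B (coset_act x) (Defs.cscale J p z v) =
  Defs.cscale J (coset_act x p) z (differential B (coset_act x) v).
Proof.
move=> tv; rewrite /Defs.cscale differential_lin -J_invariant//; congr (_ + _).
by rewrite -[_ *: J p v]addr0 differential_lin differential0 addr0.
Qed.

Lemma complex_basis_coset_act (x : G) p n
    (e : 'I_n -> (coset_space H -> R) -> R^o) :
  complex_basis B J p e ->
  complex_basis B J (coset_act x p)
    (fun i => differential B (coset_act x) (e i)).
Proof.
move=> eb; have [te be] := eb.
have xK : coset_act x^-1%g (coset_act x p) = p.
  by rewrite -[LHS]/((_ \o _) p) coset_act_mul mulVg coset_act1.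
split=> [i|v tv]; first exact: tangent_coset_act.
(* The coordinates of v in the translated basis are those of its translate by the inverse of x in
   the original one. *)
have := tangent_coset_act x^-1%g tv; rewrite xK => /be[z [zP _]].
have dsum (y : 'I_n -> R[i]) :
    \sum_(i < n) Defs.cscale J (coset_act x p) (y i)
      (differential B (coset_act x) (e i)) =
    differential B (coset_act x) (\sum_(i < n) Defs.cscale J p (y i) (e i)).
  by rewrite differential_sum; apply: eq_bigr => i _; rewrite differential_cscale.
have tsum (y : 'I_n -> R[i]) :
    tangent B p (\sum_(i < n) Defs.cscale J p (y i) (e i)).
  by apply: tangent_sum => i; exact: cscale_tangent.
exists z; split=> [|y].
  rewrite dsum -zP differential_coset_act_mul mulgV.
  by rewrite (differential_coset_act1 tv).
rewrite dsum => vE; apply/rowP => i.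
apply: (complex_basis_inj J_almost_complex eb).
rewrite -zP vE differential_coset_act_mul mulVg.
exact/differential_coset_act1/tsum.
Qed.

Lemma weyl_act_character (T : set G) (w : G) (chi : G -> R[i]) :
  normalizer T w -> is_character T chi -> is_character T (weyl_act w chi).
Proof.
move=> Nw [chiM chi1 cRe cIm].
(* Conjugation by the inverse of w is continuous and maps T into itself, so it respects
   neighbourhoods within T and continuity on T is inherited. *)
have cvgT t : T t -> (w^-1 * s * w)%g @[s --> within T (nbhs t)] -->
    within T (nbhs (w^-1 * t * w)%g).
  move=> Tt; have cw : (w^-1 * s * w)%g @[s --> t] --> (w^-1 * t * w)%g.
    apply: (lie_mul_cvg G_lie); last exact: cvg_cst.
    by apply: (lie_mul_cvg G_lie); [exact: cvg_cst|exact: cvg_id].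
  move=> S Sn.
  have : \forall s \near t, T (w^-1 * s * w)%g -> S (w^-1 * s * w)%g.
    exact: cw Sn.
  by apply: filterS => s /= TS Ts; apply: TS; exact: normalizer_conj.
split=> [s t Ts Tt|t Tt||]; rewrite /weyl_act.
- rewrite -chiM; [|exact: normalizer_conj..].
  by rewrite !mulgA -[(w^-1 * s * w * _)%g]mulgA mulgV mulg1.
- by apply: chi1; exact: normalizer_conj.
- apply/subspace_continuousP => t Tt.
  apply: (cvg_comp _ (fun s => complex.Re (chi s) : R) (cvgT t Tt)).
  exact: ((subspace_continuousP _ _).1 cRe _ (normalizer_conj Nw Tt)).
- apply/subspace_continuousP => t Tt.
  apply: (cvg_comp _ (fun s => complex.Im (chi s) : R) (cvgT t Tt)).
  exact: ((subspace_continuousP _ _).1 cIm _ (normalizer_conj Nw Tt)).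
Qed.

Lemma weights_at_weyl_act (T : set G) p n (L : 'I_n -> G -> R[i]) (w : G) :
  normalizer T w -> weights_at T B J p L ->
  weights_at T B J (coset_act w p) (fun i => weyl_act w (L i)).
Proof.
move=> Nw [chL [e eb eP]]; split=> [i|]; first exact: weyl_act_character.
exists (fun i => differential B (coset_act w) (e i)).
  exact: complex_basis_coset_act.
move=> i t Tt; have te := eb.1 i.
(* The scalar is the eigenvalue of w^-1 t w on [e i]; both sides then become the differential of one
   translation, because w (w^-1 t w) = t w. *)
rewrite -differential_cscale// -eP; last exact: normalizer_conj.
by rewrite !differential_coset_act_mul !mulgA mulgV mul1g.
Qed.

Lemma weights_at_unique (T : set G) p n (L L' : 'I_n -> G -> R[i]) :
  fixed_point T p -> weights_at T B J p L -> weights_at T B J p L' ->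
  same_weights T L L'.
Proof.
move=> fixp [_ [e eb eP]] [_ [e' eb' eP']].
have [te te'] := (eb.1, eb'.1).
have [P PE] := complex_basis_expand eb te'.
have [Q QE] := complex_basis_expand eb' te.
(* Expanding e in e' and back in e must give the identity; as both bases have n vectors, this one
   product makes P invertible. *)
have QP : Q *m P = 1%:M.
  apply/matrixP => i j.
  apply: (complex_basis_inj J_almost_complex eb (x := (Q *m P) i) (y := 1%:M i)).
  have -> : \sum_(l < n) Defs.cscale J p (1%:M i l) (e l) = e i.
    rewrite (bigD1 i)//= mxE eqxx cscale1 big1 ?addr0// => l li.
    by rewrite mxE eq_sym (negbTE li) cscale0l.
  rewrite [RHS]QE.
  under [RHS]eq_bigr => j1 _.
    rewrite PE (cscale_sumr J_almost_complex); last first.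
      by move=> l; exact: cscale_tangent.
    over.
  rewrite exchange_big /=; apply: eq_bigr => l _.
  rewrite mxE cscale_suml; apply: eq_bigr => j1 _.
  by rewrite (cscaleA J_almost_complex).
have [_ Pu] := mulmx1_unit QP.
have [s sP] := unitmx_support Pu.
exists s => i t Tt.
(* Two expressions for the coordinates in e of the image of [e' i] under t: scaling by its own
   weight, or acting on each [e j]. The nonzero entry [P i (s i)] is then cancelled. *)
have intertwine := complex_basis_inj J_almost_complex eb
  (x := fun j => L' i t * P i j) (y := fun j => P i j * L j t).
apply: (mulIf (sP i)); rewrite [RHS]mulrC; apply: intertwine.
transitivity (differential B (coset_act t) (e' i)).
  rewrite eP'// PE (cscale_sumr J_almost_complex); last first.
    by move=> l; exact: cscale_tangent.
  by apply: eq_bigr => j _; rewrite (cscaleA J_almost_complex).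
rewrite PE differential_sum; apply: eq_bigr => j _.
(* Since t fixes p, the image lies in the tangent space at p and carries the same complex
   structure. *)
by rewrite differential_cscale// fixp// eP// (cscaleA J_almost_complex).
Qed.

End Homogeneous.

(** * Weights at gH and independence of the representative *)

Lemma lcoset_subgroup (G : groupTopologicalType) (H : set G) (h : G) :
  is_subgroup H -> H h -> lcoset H h = H.
Proof.
move=> [_ HM HV] Hh; apply/seteqP; split=> [_ [x Hx <-]|x Hx]; first exact: HM.
by exists (h^-1 * x)%g; [apply: HM => //; exact: HV|rewrite mulgA mulgV mul1g].
Qed.

Theorem theorem3 (R : realType) (m n : nat)
  (G : groupTopologicalType) (A : set (chart G 'rV[R]_m))
  (G_lie : lie_group A) (G_compact : compact [set: G])
  (G_connected : connected [set: G])
  (H : set G) (H_subgroup : is_subgroup H) (H_closed : closed H)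
  (H_connected : connected H)
  (rkHG : exists r, has_rank (R := R) [set: G] r /\ has_rank (R := R) H r)
  (T : set G) (TH : T `<=` H)
  (T_maxG : maximal_torus (R := R) [set: G] T)
  (T_maxH : maximal_torus (R := R) H T)
  (B : set (chart (coset_space H) 'rV[R]_(2 * n)))
  (B_homogeneous : homogeneous_structure A B)
  (J : coset_space H -> ((coset_space H -> R) -> R^o) ->
       ((coset_space H -> R) -> R^o))
  (J_almost_complex : almost_complex_structure B J)
  (J_invariant : invariant_structure B J)
  (g : G) (g_fixed : fixed_point T (coset_proj H g))
  (w : G) (w_normalizes : normalizer T w)
  (gH_wH : coset_proj H g = coset_proj H w)
  (L : 'I_n -> G -> R[i])
  (L_weights : weights_at T B J (coset_proj H 1%g) L) :
  [/\ weights_at T B J (coset_proj H g) (fun i => weyl_act w (L i)),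
      (forall L' : 'I_n -> G -> R[i],
         weights_at T B J (coset_proj H g) L' ->
         same_weights T (fun i => weyl_act w (L i)) L')
    & (forall h : G, H h -> normalizer T h ->
         same_weights T (fun i => weyl_act w (L i))
                        (fun i => weyl_act (w * h)%g (L i)))].
Proof.
have act1 x : coset_act x (coset_proj H 1%g) = coset_proj H x.
  by rewrite coset_act_proj mulg1.
have projH h : H h -> coset_proj H h = coset_proj H 1%g.
  move=> Hh; apply/coset_projP; rewrite !lcoset_subgroup//.
  by case: H_subgroup.
(* The point gH = wH is the translate of eH by w, so the eigenbasis at eH is carried over. *)
have Lw : weights_at T B J (coset_proj H g) (fun i => weyl_act w (L i)).
  by rewrite gH_wH -act1; exact: (weights_at_weyl_act G_lie).
split=> // [L' wL'|h Hh Nh].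
  exact: (weights_at_unique J_almost_complex J_invariant g_fixed Lw wL').
have fix1 : fixed_point T (coset_proj H 1%g).
  by move=> t /TH Ht; rewrite act1 projH.
(* Translation by h in H fixes eH, so the transformed family lists weights at eH again; uniqueness
   there gives the permutation. *)
have Lh : weights_at T B J (coset_proj H 1%g) (fun i => weyl_act h (L i)).
  by rewrite -(projH h Hh) -act1; exact: (weights_at_weyl_act G_lie).
have [s sP] := weights_at_unique J_almost_complex J_invariant fix1 L_weights Lh.
(* The action is compatible with products, (w h)(L_i) = w(h(L_i)), so the permutation found at eH is
   used at the element w^-1 t w of T. *)
exists s => i t Tt; rewrite /weyl_act -sP; last exact: normalizer_conj.
by rewrite /weyl_act invgM !mulgA.
Qed.
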